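(* A ring morphism $u:A\rightarrow B$ is a PSI-morphism in each of the following cases: (i) Every prime ideal of $B$ is extended from $A$ (i.e. is of the form $u(I)B$ for some ideal $I$ of $A$). (ii) $u$ is an epimorphism. (iii) $u$ is surjective. (iv) $u$ is the canonical map from $A$ to a fraction ring $B=A_S$ of $A$ ($S$ a multiplicative subset of $A$).
   Context: All rings are commutative and unitary, and ring morphisms are unitary. For a ring morphism $u:A\to B$, a proper ideal $I$ of $B$ is called $A$-prime if $u(a)b\in I$ with $a\in A$ and $b\in B$ implies that $u(a)\in I$ or $b\in I$. The morphism $u$ is a PSI-morphism if every $A$-prime ideal of $B$ is a prime ideal of $B$. The morphism $u$ is an epimorphism if the canonical multiplication map $B\otimes_A B\to B$ is an isomorphism. *)

(* Defs.v *)
From HB Require Import structures.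
From mathcomp Require Import all_boot all_algebra.
From mathcomp Require Import boolp classical_sets.
From mathcomp Require Import freeg.
From mathcomp Require Import ring.

Set Implicit Arguments.
Unset Strict Implicit.
Unset Printing Implicit Defensive.

Import GRing.Theory.

Local Open Scope ring_scope.
Local Open Scope classical_set_scope.
Local Open Scope quotient_scope.

(* Rings are [comPzRingType]s, so that the zero ring is allowed; this is why
   the ideals of MathComp's ring_quotient, which require 1 != 0, are not used. *)

Section Ideals.
Context (R : comPzRingType).
Implicit Types (I X : set R).

Definition is_ideal I : Prop :=
  [/\ I 0, forall x y, I x -> I y -> I (x + y) & forall a x, I x -> I (a * x)].

Definition is_proper_ideal I : Prop := is_ideal I /\ ~ I 1.

Definition is_prime_ideal I : Prop :=
  is_proper_ideal I /\ forall x y, I (x * y) -> I x \/ I y.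

Definition ideal_generated X : set R := smallest is_ideal X.

End Ideals.

Section Morphisms.
Context (A B : comPzRingType) (u : {rmorphism A -> B}).

Definition is_Aprime (I : set B) : Prop :=
  is_proper_ideal I /\ forall a b, I (u a * b) -> I (u a) \/ I b.

Definition PSI_morphism : Prop :=
  forall I : set B, is_Aprime I -> is_prime_ideal I.

Definition extended_ideal (J : set B) : Prop :=
  exists2 I : set A, is_ideal I & J = ideal_generated (u @` I).

End Morphisms.

(* The additive extension of a function on a basis of a free abelian group. *)
Section FreeAbelian.
Context (K : choiceType) (V : zmodType) (h : K -> V).

Definition fgext (x : {freeg K / int}) : V :=
  fglift (h : K -> ssrint.zmodule V) x.

Lemma fgext_zmod_morphism : zmod_morphism fgext.
Proof. exact: (@lift_is_additive int K (ssrint.zmodule V) h). Qed.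

HB.instance Definition _ :=
  GRing.isZmodMorphism.Build {freeg K / int} V fgext fgext_zmod_morphism.

Lemma fgextU k : fgext << k >> = h k.
Proof. by rewrite /fgext liftU scale1r. Qed.

End FreeAbelian.

Lemma freeg_addind (K : choiceType) (P : {freeg K / int} -> Prop) :
  P 0 -> (forall x y, P x -> P y -> P (x + y)) -> (forall x, P x -> P (- x)) ->
  (forall k, P << k >>) -> forall x, P x.
Proof.
move=> P0 PD PN PU; have PX k n : P (<< k >> *+ n).
  by elim: n => [|n IHn]; rewrite ?mulr0n // mulrS; apply: PD.
elim/freeg_ind_dom0 => // m k D _ _ PDD; apply: PD => //.
have -> : << m *g k >> = << k >> *~ m :> {freeg K / int}.
  by rewrite freegU_mulz intz.
case: m => n; first exact: PX.
by rewrite NegzE mulrNz; apply/PN/PX.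
Qed.

(* The monoid ring of the multiplicative monoid of [R] over the integers. *)
Section MonoidRing.
Context (R : comPzRingType).
Local Notation F := {freeg R / int}.
Implicit Types x y z : F.

Definition fgmul x y : F := fgext (fun k => fgext (fun l => << k * l >>) y) x.

Lemma fgmulUU (k l : R) : fgmul << k >> << l >> = << k * l >>.
Proof. by rewrite /fgmul !fgextU. Qed.

Lemma fgmul0l y : fgmul 0 y = 0. Proof. exact: raddf0. Qed.
Lemma fgmulNl x y : fgmul (- x) y = - fgmul x y. Proof. exact: raddfN. Qed.
Lemma fgmulDl x x' y : fgmul (x + x') y = fgmul x y + fgmul x' y.
Proof. exact: raddfD. Qed.

Lemma fgmulC : commutative fgmul.
Proof.
have mulU0 k : fgmul << k >> 0 = 0 by rewrite /fgmul fgextU raddf0.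
have mulUN k x : fgmul << k >> (- x) = - fgmul << k >> x.
  by rewrite /fgmul !fgextU raddfN.
have mulUD k x y : fgmul << k >> (x + y) = fgmul << k >> x + fgmul << k >> y.
  by rewrite /fgmul !fgextU raddfD.
have mulUC k y : fgmul << k >> y = fgmul y << k >>.
  elim/freeg_addind: y => [|y z IHy IHz|y IHy|l].
  - by rewrite mulU0 fgmul0l.
  - by rewrite mulUD fgmulDl IHy IHz.
  - by rewrite mulUN fgmulNl IHy.
  - by rewrite !fgmulUU mulrC.
have mulr0' x : fgmul x 0 = 0.
  rewrite /fgmul; elim/freeg_addind: x => [|x y IHx IHy|x IHx|l].
  - exact: raddf0.
  - by rewrite raddfD /= IHx IHy addr0.
  - by rewrite raddfN /= IHx oppr0.
  - exact: mulU0.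
have mulrN' x y : fgmul x (- y) = - fgmul x y.
  elim/freeg_addind: x => [|x x' IHx IHx'|x IHx|l].
  - by rewrite !fgmul0l oppr0.
  - by rewrite !fgmulDl IHx IHx' opprD.
  - by rewrite !fgmulNl IHx.
  - exact: mulUN.
have mulrD' x y z : fgmul x (y + z) = fgmul x y + fgmul x z.
  elim/freeg_addind: x => [|x x' IHx IHx'|x IHx|l].
  - by rewrite !fgmul0l addr0.
  - by rewrite !fgmulDl IHx IHx' addrACA.
  - by rewrite !fgmulNl IHx opprD.
  - exact: mulUD.
move=> x y; elim/freeg_addind: x => [|x x' IHx IHx'|x IHx|l].
- by rewrite fgmul0l mulr0'.
- by rewrite fgmulDl mulrD' IHx IHx'.
- by rewrite fgmulNl mulrN' IHx.
- exact: mulUC.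
Qed.

Lemma fgmul0r x : fgmul x 0 = 0. Proof. by rewrite fgmulC fgmul0l. Qed.
Lemma fgmulNr x y : fgmul x (- y) = - fgmul x y.
Proof. by rewrite !(fgmulC x) fgmulNl. Qed.
Lemma fgmulDr x y y' : fgmul x (y + y') = fgmul x y + fgmul x y'.
Proof. by rewrite !(fgmulC x) fgmulDl. Qed.

Lemma fgmulBr x y y' : fgmul x (y - y') = fgmul x y - fgmul x y'.
Proof. by rewrite fgmulDr fgmulNr. Qed.

Lemma fgmulA : associative fgmul.
Proof.
move=> x y z; elim/freeg_addind: x => [|x x' IHx IHx'|x IHx|k].
- by rewrite !fgmul0l.
- by rewrite !fgmulDl IHx IHx'.
- by rewrite !fgmulNl IHx.
elim/freeg_addind: y => [|x x' IHx IHx'|x IHx|l].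
- by rewrite fgmul0r !fgmul0l fgmul0r.
- by rewrite fgmulDr !fgmulDl fgmulDr IHx IHx'.
- by rewrite fgmulNr !fgmulNl fgmulNr IHx.
elim/freeg_addind: z => [|x x' IHx IHx'|x IHx|m].
- by rewrite !fgmul0r.
- by rewrite !fgmulDr IHx IHx'.
- by rewrite !fgmulNr IHx.
- by rewrite !fgmulUU mulrA.
Qed.

Lemma fgmul1l : left_id << 1 >> fgmul.
Proof.
elim/freeg_addind => [|x y IHx IHy|x IHx|k].
- exact: fgmul0r.
- by rewrite fgmulDr IHx IHy.
- by rewrite fgmulNr IHx.
- by rewrite fgmulUU mul1r.
Qed.

End MonoidRing.

(* The tensor product of two A-algebras f : A -> B and g : A -> C: the free
   abelian group on B * C modulo the subgroup generated by the bilinearity and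
   A-balancedness relations. *)
Section Tensor.
Context (A B C : comPzRingType).
Context (f : {rmorphism A -> B}) (g : {rmorphism A -> C}).
Local Notation F := {freeg (B * C)%type / int}.

Inductive tensor_rel : set F :=
| TensorDl b b' c :
    tensor_rel (<< (b + b', c) >> - (<< (b, c) >> + << (b', c) >>))
| TensorDr b c c' :
    tensor_rel (<< (b, c + c') >> - (<< (b, c) >> + << (b, c') >>))
| TensorZ a b c :
    tensor_rel (<< (f a * b, c) >> - << (b, g a * c) >>).

Definition is_subgroup (H : set F) : Prop :=
  H 0 /\ forall x y, H x -> H y -> H (x - y).

Definition tensor_ker : pred F :=
  fun x => `[< smallest is_subgroup tensor_rel x >].

Lemma tensor_ker_zmod_closed : zmod_closed tensor_ker.
Proof.
split=> [|x y]; first by apply/asboolP => H [[]].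
move=> /asboolP Hx /asboolP Hy; apply/asboolP => H HH.
by have [[_ HB] _] := HH; apply: HB; [apply: Hx|apply: Hy].
Qed.

HB.instance Definition _ := GRing.isZmodClosed.Build F tensor_ker
  tensor_ker_zmod_closed.

Definition tensor : Type := Quotient.quot (GRing.ZmodClosed.clone F tensor_ker _).

HB.instance Definition _ := GRing.Zmodule.on tensor.
HB.instance Definition _ := EqQuotient.on tensor.

Lemma eq_tensor (x y : F) : x = y %[mod tensor] <-> x - y \in tensor_ker.
Proof. by rewrite Quotient.idealrBE; split=> /eqP. Qed.

Lemma tensor_ker_ind (P : F -> Prop) :
  P 0 -> (forall x y, P x -> P y -> P (x - y)) ->
  (forall x, tensor_rel x -> P x) -> forall x, x \in tensor_ker -> P x.
Proof. by move=> P0 PB PR x /asboolP; apply. Qed.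

Lemma tensor_rel_ker x : tensor_rel x -> x \in tensor_ker.
Proof. by move=> Rx; apply/asboolP => H [_]; apply. Qed.

Lemma tensor_ker_mul x y : y \in tensor_ker -> fgmul x y \in tensor_ker.
Proof.
elim/tensor_ker_ind: y / => [|y z Hy Hz|y Ry].
- by rewrite fgmul0r rpred0.
- by rewrite fgmulBr rpredB.
elim/freeg_addind: x => [|x x' Hx Hx'|x Hx|[b0 c0]].
- by rewrite fgmul0l rpred0.
- by rewrite fgmulDl rpredD.
- by rewrite fgmulNl rpredN.
apply: tensor_rel_ker.
have pairM b c b' c' : (b, c) * (b', c') = (b * b', c * c') :> B * C by [].
case: Ry => *; rewrite !(fgmulBr, fgmulDr) !fgmulUU !pairM.
- by rewrite mulrDr; constructor.
- by rewrite mulrDr; constructor.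
- by rewrite mulrCA [c0 * (_ * _)]mulrCA; constructor.
Qed.

Definition tensor_one : tensor := lift_cst tensor << (1, 1) >>.
Definition tensor_prod := lift_op2 tensor (@fgmul (B * C)%type).

Canonical pi_tensor_one := PiConst tensor_one.

Lemma pi_tensor_prod : {morph \pi_tensor : x y / fgmul x y >-> tensor_prod x y}.
Proof.
move=> x y; unlock tensor_prod; apply/eq_tensor.
set x' := repr _; set y' := repr _.
have -> : fgmul x y - fgmul x' y' = fgmul y (x - x') + fgmul x' (y - y').
  by rewrite !fgmulBr !(fgmulC y) addrA subrK.
by rewrite rpredD // tensor_ker_mul //; apply/eq_tensor; rewrite reprK.
Qed.
Canonical pi_tensor_prod_morph := PiMorph2 pi_tensor_prod.

Lemma tensor_prodA : associative tensor_prod.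
Proof.
by elim/quotW=> x; elim/quotW=> y; elim/quotW=> z; rewrite !piE fgmulA.
Qed.

Lemma tensor_prodC : commutative tensor_prod.
Proof. by elim/quotW=> x; elim/quotW=> y; rewrite !piE fgmulC. Qed.

Lemma tensor_prod1l : left_id tensor_one tensor_prod.
Proof.
elim/quotW=> x; rewrite piE -[in RHS](fgmul1l x).
reflexivity.
Qed.

Lemma tensor_prodDl : left_distributive tensor_prod +%R.
Proof.
elim/quotW=> x; elim/quotW=> y; elim/quotW=> z.
by rewrite !piE fgmulDl.
Qed.

HB.instance Definition _ := GRing.Zmodule_isComPzRing.Build tensor
  tensor_prodA tensor_prodC tensor_prod1l tensor_prodDl.

Definition tens (b : B) (c : C) : tensor := \pi_tensor << (b, c) >>.

End Tensor.

Section Multiplication.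
Context (A B : comPzRingType) (u : {rmorphism A -> B}).

(* The canonical map B (x)_A B -> B, b (x) c |-> b * c; see [tensor_multE]. *)
Definition tensor_mult (t : tensor u u) : B :=
  fgext (fun p : B * B => p.1 * p.2) (repr t).

Lemma tensor_mult_pi (x : {freeg (B * B)%type / int}) :
  tensor_mult (\pi x) = fgext (fun p : B * B => p.1 * p.2) x.
Proof.
apply/eqP; rewrite -subr_eq0 -raddfB /=; apply/eqP.
have : repr (\pi_(tensor u u) x) - x \in tensor_ker u u.
  by apply/eq_tensor; rewrite reprK.
elim/tensor_ker_ind => [|y z Hy Hz|y]; first exact: raddf0.
  by rewrite raddfB /= Hy Hz subr0.
case=> *; rewrite !(raddfB, raddfD) /= !fgextU /=.
- by rewrite mulrDl -opprD subrr.
- by rewrite mulrDr -opprD subrr.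
- by rewrite mulrA [X in X * _]mulrC subrr.
Qed.

Lemma tensor_multE b c : tensor_mult (tens u u b c) = b * c.
Proof. by rewrite tensor_mult_pi fgextU. Qed.

Lemma tensor_mult_zmod_morphism : zmod_morphism tensor_mult.
Proof.
elim/quotW=> x; elim/quotW=> y.
by rewrite -[_ - _]raddfB !tensor_mult_pi raddfB.
Qed.

HB.instance Definition _ := GRing.isZmodMorphism.Build (tensor u u) B
  tensor_mult tensor_mult_zmod_morphism.

Lemma tensor_mult_monoid_morphism : monoid_morphism tensor_mult.
Proof.
split.
  rewrite [1]/(tensor_one u u); unlock tensor_one.
  by rewrite tensor_mult_pi fgextU mul1r.
elim/quotW=> x; elim/quotW=> y.
rewrite -[_ * _]pi_tensor_prod !tensor_mult_pi.
elim/freeg_addind: x => [|x x' Hx Hx'|x Hx|k].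
- by rewrite fgmul0l raddf0 mul0r.
- by rewrite fgmulDl !raddfD /= Hx Hx' mulrDl.
- by rewrite fgmulNl !raddfN /= Hx mulNr.
elim/freeg_addind: y => [|x x' Hx Hx'|x Hx|l].
- by rewrite fgmul0r raddf0 mulr0.
- by rewrite fgmulDr !raddfD /= Hx Hx' mulrDr.
- by rewrite fgmulNr !raddfN /= Hx mulrN.
- by rewrite fgmulUU !fgextU /= mulrACA.
Qed.

HB.instance Definition _ := GRing.isMonoidMorphism.Build (tensor u u) B
  tensor_mult tensor_mult_monoid_morphism.

Definition ring_epimorphism : Prop := bijective tensor_mult.

End Multiplication.

Record multSubset (A : comPzRingType) := MultSubset {
  mult_set : set A;
  mult_set1 : mult_set 1;
  mult_setM : forall s t, mult_set s -> mult_set t -> mult_set (s * t)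
}.

Section Fractions.
Context (A : comPzRingType) (S : multSubset A).

(* [(a, s)] stands for the fraction a / s. *)
Definition fpair : Type := (A * {s : A | `[< mult_set S s >]})%type.
HB.instance Definition _ := Choice.on fpair.
Implicit Types x y z : fpair.

Definition num x : A := x.1.
Definition den x : A := val x.2.

Lemma den_mult x : mult_set S (den x). Proof. exact/asboolP/(valP x.2). Qed.

Definition mkfpair (a s : A) (Ss : mult_set S s) : fpair := (a, Sub s (asboolT Ss)).

Lemma num_mk a s Ss : num (@mkfpair a s Ss) = a. Proof. by []. Qed.
Lemma den_mk a s Ss : den (@mkfpair a s Ss) = s. Proof. exact: SubK. Qed.

Definition frac_eq x y : bool :=
  `[< exists2 t, mult_set S t & t * (num x * den y - num y * den x) = 0 >].

Lemma frac_eq_refl : reflexive frac_eq.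
Proof.
by move=> x; apply/asboolP; exists 1; [exact: mult_set1|rewrite subrr mulr0].
Qed.

Lemma frac_eq_sym : symmetric frac_eq.
Proof.
have imp x y : frac_eq x y -> frac_eq y x.
  move=> /asboolP[t St e]; apply/asboolP; exists t => //.
  by rewrite -opprB mulrN e oppr0.
by move=> x y; apply/idP/idP; exact: imp.
Qed.

Lemma frac_eq_trans : transitive frac_eq.
Proof.
move=> y x z /asboolP[t St e1] /asboolP[r Sr e2]; apply/asboolP.
exists (t * r * den y); first by do !apply: mult_setM => //; exact: den_mult.
transitivity (r * den z * (t * (num x * den y - num y * den x))
            + t * den x * (r * (num y * den z - num z * den y))); first ring.
by rewrite e1 e2 !mulr0 addr0.
Qed.

Canonical frac_equiv := EquivRel frac_eq frac_eq_refl frac_eq_sym frac_eq_trans.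

Definition fraction_ring : Type := {eq_quot frac_eq}.
HB.instance Definition _ : EqQuotient _ frac_eq fraction_ring :=
  EqQuotient.on fraction_ring.
HB.instance Definition _ := Choice.on fraction_ring.

Lemma eq_fracP x y :
  reflect (exists2 t, mult_set S t & t * (num x * den y - num y * den x) = 0)
    (x == y %[mod fraction_ring]).
Proof. by rewrite eqmodE; exact: asboolP. Qed.

Definition fpair_of (a : A) : fpair := mkfpair a (mult_set1 S).
Definition addf x y : fpair :=
  mkfpair (num x * den y + num y * den x)
    (mult_setM (den_mult x) (den_mult y)).
Definition oppf x : fpair := mkfpair (- num x) (den_mult x).
Definition mulf x y : fpair :=
  mkfpair (num x * num y) (mult_setM (den_mult x) (den_mult y)).

Definition frac_map : A -> fraction_ring :=
  lift_embed fraction_ring fpair_of.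
Canonical frac_map_pi_morph := PiEmbed frac_map.

Definition frac_add := lift_op2 fraction_ring addf.
Definition frac_opp := lift_op1 fraction_ring oppf.
Definition frac_mul := lift_op2 fraction_ring mulf.

Lemma pi_frac_add : {morph \pi : x y / addf x y >-> frac_add x y}.
Proof.
move=> x y; unlock frac_add; apply/eqP/eq_fracP.
set x' := repr _; set y' := repr _.
have /eqP/eq_fracP[t St et] : \pi_fraction_ring x = \pi_fraction_ring x'.
  by rewrite reprK.
have /eqP/eq_fracP[r Sr er] : \pi_fraction_ring y = \pi_fraction_ring y'.
  by rewrite reprK.
exists (t * r); first exact: mult_setM.
rewrite !num_mk !den_mk.
transitivity (r * den y * den y' * (t * (num x * den x' - num x' * den x))
            + t * den x * den x' * (r * (num y * den y' - num y' * den y))).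
  ring.
by rewrite et er !mulr0 addr0.
Qed.
Canonical pi_frac_add_morph := PiMorph2 pi_frac_add.

Lemma pi_frac_opp : {morph \pi : x / oppf x >-> frac_opp x}.
Proof.
move=> x; unlock frac_opp; apply/eqP/eq_fracP.
set x' := repr _.
have /eqP/eq_fracP[t St et] : \pi_fraction_ring x = \pi_fraction_ring x'.
  by rewrite reprK.
exists t => //; rewrite !num_mk !den_mk.
transitivity (- (t * (num x * den x' - num x' * den x))); first ring.
by rewrite et oppr0.
Qed.
Canonical pi_frac_opp_morph := PiMorph1 pi_frac_opp.

Lemma pi_frac_mul : {morph \pi : x y / mulf x y >-> frac_mul x y}.
Proof.
move=> x y; unlock frac_mul; apply/eqP/eq_fracP.
set x' := repr _; set y' := repr _.
have /eqP/eq_fracP[t St et] : \pi_fraction_ring x = \pi_fraction_ring x'.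
  by rewrite reprK.
have /eqP/eq_fracP[r Sr er] : \pi_fraction_ring y = \pi_fraction_ring y'.
  by rewrite reprK.
exists (t * r); first exact: mult_setM.
rewrite !num_mk !den_mk.
transitivity (r * num y * den y' * (t * (num x * den x' - num x' * den x))
            + t * num x' * den x * (r * (num y * den y' - num y' * den y))).
  ring.
by rewrite et er !mulr0 addr0.
Qed.
Canonical pi_frac_mul_morph := PiMorph2 pi_frac_mul.

Let eq_frac x y : num x * den y = num y * den x ->
  \pi_fraction_ring x = \pi_fraction_ring y.
Proof.
move=> e; apply/eqP/eq_fracP; exists 1; first exact: mult_set1.
by rewrite e subrr mulr0.
Qed.

Lemma frac_addA : associative frac_add.
Proof.
elim/quotW=> x; elim/quotW=> y; elim/quotW=> z; rewrite !piE.
by apply: eq_frac; rewrite !num_mk !den_mk; ring.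
Qed.

Lemma frac_addC : commutative frac_add.
Proof.
elim/quotW=> x; elim/quotW=> y; rewrite !piE.
by apply: eq_frac; rewrite !num_mk !den_mk; ring.
Qed.

Lemma frac_add0l : left_id (frac_map 0) frac_add.
Proof.
elim/quotW=> x; rewrite !piE.
by apply: eq_frac; rewrite !num_mk !den_mk; ring.
Qed.

Lemma frac_addNl : left_inverse (frac_map 0) frac_opp frac_add.
Proof.
elim/quotW=> x; rewrite !piE.
by apply: eq_frac; rewrite !num_mk !den_mk; ring.
Qed.

HB.instance Definition _ := GRing.isZmodule.Build fraction_ring
  frac_addA frac_addC frac_add0l frac_addNl.

Lemma frac_mulA : associative frac_mul.
Proof.
elim/quotW=> x; elim/quotW=> y; elim/quotW=> z; rewrite !piE.
by apply: eq_frac; rewrite !num_mk !den_mk; ring.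
Qed.

Lemma frac_mulC : commutative frac_mul.
Proof.
elim/quotW=> x; elim/quotW=> y; rewrite !piE.
by apply: eq_frac; rewrite !num_mk !den_mk; ring.
Qed.

Lemma frac_mul1l : left_id (frac_map 1) frac_mul.
Proof.
elim/quotW=> x; rewrite !piE.
by apply: eq_frac; rewrite !num_mk !den_mk; ring.
Qed.

Lemma frac_mulDl : left_distributive frac_mul frac_add.
Proof.
elim/quotW=> x; elim/quotW=> y; elim/quotW=> z; rewrite !piE.
by apply: eq_frac; rewrite !num_mk !den_mk; ring.
Qed.

HB.instance Definition _ := GRing.Zmodule_isComPzRing.Build fraction_ring
  frac_mulA frac_mulC frac_mul1l frac_mulDl.

Lemma frac_map_zmod_morphism : zmod_morphism frac_map.
Proof.
move=> a b; rewrite [LHS]piE; rewrite -[RHS]/(frac_add _ (frac_opp _)) !piE.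
by apply: eq_frac; rewrite !num_mk !den_mk; ring.
Qed.

HB.instance Definition _ := GRing.isZmodMorphism.Build A fraction_ring
  frac_map frac_map_zmod_morphism.

Lemma frac_map_monoid_morphism : monoid_morphism frac_map.
Proof.
split=> // a b; rewrite [LHS]piE; rewrite -[RHS]/(frac_mul _ _) !piE.
by apply: eq_frac; rewrite !num_mk !den_mk; ring.
Qed.

HB.instance Definition _ := GRing.isMonoidMorphism.Build A fraction_ring
  frac_map frac_map_monoid_morphism.

End Fractions.

(* [u] is, up to an isomorphism of A-algebras, the canonical map to A_S. *)
Definition is_fraction_map (A B : comPzRingType) (u : {rmorphism A -> B})
    (S : multSubset A) : Prop :=
  exists2 phi : {rmorphism fraction_ring S -> B},
    bijective phi & forall a, u a = phi (frac_map S a).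

(* Main.v *)
Require Import Defs.
From mathcomp Require Import all_boot all_algebra.
From mathcomp Require Import boolp classical_sets.
From mathcomp Require Import freeg ring.

(** Let I be an A-prime ideal of B, and let S be the complement of u^-1(I) in
    A. Then S is a multiplicative set, and B/I is S-torsion-free: if u(s)x is
    in I with s in S, then x is in I. So everything takes place inside the
    localization C of B/I at S, an algebra over the residue field k of A at
    u^-1(I).

    If C = k, then I is prime, because B/I embeds in a field. In terms of
    elements this says that each b in B satisfies u(s)b = u(a) modulo I for
    some s in S and a in A ([Aprime_fraction_prime]). It is immediate when u is
    surjective or a localization.

    The other two cases choose an S-saturated submodule N of B, over B or over
    A, which is maximal among those that contain a given one but not 1
    ([maximal_saturated]).

    - If every prime is extended, take N to be an ideal containing I. Its
      maximality makes it prime, hence generated by elements u(a). None of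
      these a is in S, for u(s) in N would give 1 in N by saturation; so N is
      contained in I, and I = N is prime.

    - If u is an epimorphism, fix b that is not a fraction modulo I. Then 1 and
      b are linearly independent in C over k. A maximal N among A-submodules
      containing I and b is the trace of a hyperplane of C, that is, the kernel
      of a k-linear form L : C -> k with L(1) = 1 and L(b) = 0. The balanced
      map (x, y) |-> L(x)y sends (b, 1) to 0 and (1, b) to b; since
      b (x) 1 = 1 (x) b for an epimorphism, b vanishes in C, which is absurd. *)

Set Implicit Arguments.
Unset Strict Implicit.
Unset Printing Implicit Defensive.

Import GRing.Theory.

Local Open Scope ring_scope.
Local Open Scope classical_set_scope.
Local Open Scope quotient_scope.

(** * Maximal saturated submodules *)

Section Saturated.
Context (R B : comPzRingType) (v : {rmorphism R -> B}) (T : multSubset R).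
Implicit Types N : set B.

Definition saturated_submod N : Prop :=
  [/\ N 0, forall x y, N x -> N y -> N (x + y),
      forall r x, N x -> N (v r * x)
    & forall t x, mult_set T t -> N (v t * x) -> N x].

Lemma saturatedN N x : saturated_submod N -> N x -> N (- x).
Proof. by case=> _ _ NZ _ /(NZ (-1)); rewrite rmorphN1 mulN1r. Qed.

Lemma saturatedB N x y : saturated_submod N -> N x -> N y -> N (x - y).
Proof. by move=> HN Nx /(saturatedN HN); case: HN => _ ND _ _; apply: ND. Qed.

(** The saturation of N + Rx. *)
Definition adjoin N x : set B :=
  [set y | exists t r, mult_set T t /\ N (v t * y - v r * x)].

Lemma adjoin_sub N x : N `<=` adjoin N x.
Proof.
move=> y Ny; exists 1, 0; split; first exact: mult_set1.
by rewrite rmorph1 rmorph0 mul1r mul0r subr0.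
Qed.

Lemma adjoin_mem N x : saturated_submod N -> adjoin N x x.
Proof.
case=> N0 _ _ _; exists 1, 1; split; first exact: mult_set1.
by rewrite subrr.
Qed.

Lemma adjoin_saturated N x :
  saturated_submod N -> saturated_submod (adjoin N x).
Proof.
move=> HN; have [N0 ND NZ NS] := HN; split.
- exact: adjoin_sub.
- move=> y z [t [r [Tt Ny]]] [t' [r' [Tt' Nz]]].
  exists (t * t'), (t' * r + t * r'); split; first exact: mult_setM.
  have -> : v (t * t') * (y + z) - v (t' * r + t * r') * x =
    v t' * (v t * y - v r * x) + v t * (v t' * z - v r' * x) by ring.
  by apply: ND; apply: NZ.
- move=> a y [t [r [Tt Ny]]]; exists t, (a * r); split=> //.
  have -> : v t * (v a * y) - v (a * r) * x = v a * (v t * y - v r * x) by ring.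
  exact: NZ.
- move=> t y Tt [t' [r [Tt' Ny]]]; exists (t' * t), r.
  by split; [exact: mult_setM|rewrite rmorphM -mulrA].
Qed.

(** If N is maximal, adjoining any new element x and saturating must produce 1.
    So 1 lies in every nonzero submodule of the localization of B/N at T; this
    makes N a prime ideal when R = B, and a hyperplane when the localization of
    R acts on that of B/N through a field. *)
Lemma maximal_saturated N0 : saturated_submod N0 -> ~ N0 1 ->
  exists N, [/\ saturated_submod N, ~ N 1, N0 `<=` N
    & forall x, ~ N x -> exists t r, mult_set T t /\ N (v t - v r * x)].
Proof.
move=> HN0 N01.
(* The union with N0 makes the property hold for the empty chain. *)
pose P X := saturated_submod (X `|` N0) /\ ~ (X `|` N0) 1.
have [|X [[HX X1] maxX]] := @Zorn_bigcup B P.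
  move=> F FP Ftot.
  have [[X FX]|F0] := pselect (exists X, F X); last first.
    have -> : \bigcup_(X in F) X = set0.
      by apply/seteqP; split=> // x [X FX]; case: F0; exists X.
    by rewrite /P set0U.
  have lift Y x : F Y -> (Y `|` N0) x -> (\bigcup_(X in F) X `|` N0) x.
    by move=> FY [Yx|]; [left; exists Y|right].
  have mem x : (\bigcup_(X in F) X `|` N0) x ->
      exists2 Y, F Y & (Y `|` N0) x.
    by case=> [[Y FY Yx]|N0x]; [exists Y => //; left|exists X => //; right].
  split; last by move=> /mem[Y /FP[_]].
  split.
  - by apply: (lift X) => //; have [[]] := FP _ FX.
  - move=> x y /mem[Y FY Yx] /mem[Z FZ Zy].
    have [YZ|ZY] := Ftot _ _ FY FZ.
      apply: (lift Z) => //; have [[_ ZD _ _] _] := FP _ FZ.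
      by apply: ZD => //; apply: setSU Yx.
    apply: (lift Y) => //; have [[_ YD _ _] _] := FP _ FY.
    by apply: YD => //; apply: setSU Zy.
  - move=> r x /mem[Y FY Yx]; apply: (lift Y) => //.
    by have [[_ _ YZ _] _] := FP _ FY; apply: YZ.
  - move=> t x Tt /mem[Y FY Yx]; apply: (lift Y) => //.
    by have [[_ _ _ YS] _] := FP _ FY; apply: YS Tt Yx.
exists (X `|` N0); split=> // x Nx.
apply: contrapT => no1; apply: (maxX (adjoin (X `|` N0) x)).
  split; first by move=> y Xy; apply: adjoin_sub; left.
  by move=> /(_ _ (adjoin_mem x HX)) Xx; apply: Nx; left.
rewrite /P; have -> : adjoin (X `|` N0) x `|` N0 = adjoin (X `|` N0) x.
  by apply: setUidl => y N0y; apply: adjoin_sub; right.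
split; first exact: adjoin_saturated.
by move=> [t [r [Tt Nt]]]; apply: no1; exists t, r; rewrite -(mulr1 (v t)).
Qed.

End Saturated.

(** * Rings of fractions *)

Section FractionRing.
Context (A : comPzRingType) (S : multSubset A).

Lemma frac_map_eq0 a :
  frac_map S a = 0 -> exists2 s, mult_set S s & s * a = 0.
Proof.
rewrite -[RHS]/(frac_map S 0) !piE => /eqP/eq_fracP[s Ss].
rewrite !num_mk !den_mk mulr1 mul0r subr0; exact: ex_intro2.
Qed.

Lemma frac_map_num (z : fraction_ring S) :
  exists s a, mult_set S s /\ frac_map S s * z = frac_map S a.
Proof.
elim/quotW: z => x; exists (den x), (num x); split; first exact: den_mult.
rewrite -[LHS]/(frac_mul _ _) !piE; apply/eqP/eq_fracP.
exists 1; first exact: mult_set1.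
by rewrite !num_mk !den_mk; ring.
Qed.

Lemma frac_map_inv s : mult_set S s -> exists w, w * frac_map S s = 1.
Proof.
move=> Ss; exists (\pi_(fraction_ring S) (mkfpair 1 Ss)).
rewrite -[RHS]/(frac_map S 1) -[LHS]/(frac_mul _ _) !piE.
apply/eqP/eq_fracP; exists 1; first exact: mult_set1.
by rewrite !num_mk !den_mk; ring.
Qed.

End FractionRing.

Section ImageMultSubset.
Context (A B : comPzRingType) (u : {rmorphism A -> B}) (S : multSubset A).

Lemma image_mult1 : (u @` mult_set S) 1.
Proof. by exists 1; [exact: mult_set1|exact: rmorph1]. Qed.

Lemma image_multM s t :
  (u @` mult_set S) s -> (u @` mult_set S) t -> (u @` mult_set S) (s * t).
Proof.
move=> [a Sa <-] [b Sb <-].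
by exists (a * b); [exact: mult_setM|exact: rmorphM].
Qed.

Definition image_mult : multSubset B := MultSubset image_mult1 image_multM.

End ImageMultSubset.

(** * The tensor square of an epimorphism *)

(** In an epimorphism b (x) 1 = 1 (x) b. The values of h need only be
    bilinear and balanced modulo J, so that h can be built by arbitrary
    choices of representatives. *)
Lemma epimorphism_balanced (A B : comPzRingType) (u : {rmorphism A -> B})
    (V : zmodType) (J : set V) (h : B -> B -> V) (b : B) :
  ring_epimorphism u -> J 0 -> (forall x y, J x -> J y -> J (x - y)) ->
  (forall x x' y, J (h (x + x') y - (h x y + h x' y))) ->
  (forall x y y', J (h x (y + y') - (h x y + h x y'))) ->
  (forall a x y, J (h (u a * x) y - h x (u a * y))) ->
  J (h b 1 - h 1 b).
Proof.
move=> /bij_inj injm J0 JB hDl hDr hZ.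
have /eq_tensor : tens u u b 1 = tens u u 1 b.
  by apply: injm; rewrite !tensor_multE mulrC.
pose H := fgext (fun p : B * B => h p.1 p.2).
have -> : h b 1 - h 1 b = H (<< (b, 1) >> - << (1, b) >>).
  by rewrite /H raddfB /= !fgextU.
elim/tensor_ker_ind=> [|x y Jx Jy|x].
- by rewrite /H raddf0.
- by rewrite /H raddfB; apply: JB.
- by case=> *; rewrite /H !(raddfB, raddfD) /= !fgextU /= -?opprD.
Qed.

(** * Relative primes *)

Section Aprime.
Context (A B : comPzRingType) (u : {rmorphism A -> B}) (I : set B).
Hypothesis HI : is_Aprime u I.

Let I0 : I 0. Proof. by case: HI => -[[]]. Qed.
Let ID x y : I x -> I y -> I (x + y).
Proof. by case: HI => -[[_ + _] _] _; apply. Qed.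
Let IM a x : I x -> I (a * x).
Proof. by case: HI => -[[_ _ +] _] _; apply. Qed.
Let I1 : ~ I 1. Proof. by case: HI => -[]. Qed.
Let IB x y : I x -> I y -> I (x - y).
Proof. by move=> Ix Iy; rewrite -mulN1r; apply: ID => //; apply: IM. Qed.

Lemma Aprime_compl1 : [set s | ~ I (u s)] 1.
Proof. by rewrite /= rmorph1. Qed.

Lemma Aprime_complM s t : [set s | ~ I (u s)] s -> [set s | ~ I (u s)] t ->
  [set s | ~ I (u s)] (s * t).
Proof. by move=> /= Ss St; rewrite rmorphM; case: HI => _ /[apply] -[]. Qed.

(** The complement of the prime ideal of A under I. *)
Definition Aprime_compl : multSubset A := MultSubset Aprime_compl1 Aprime_complM.

Lemma Aprime_saturated s x : ~ I (u s) -> I (u s * x) -> I x.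
Proof. by move=> Ss; case: HI => _ /[apply] => -[]. Qed.

(** The hypothesis says that B/I lies in the residue field of A under I. *)
Lemma Aprime_fraction_prime :
  (forall b, exists s a, ~ I (u s) /\ I (u s * b - u a)) -> is_prime_ideal I.
Proof.
move=> frac; split; first by case: HI.
move=> x y Ixy; have [s [a [Ss Ix]]] := frac x.
have : I (u a * y).
  have -> : u a * y = u s * (x * y) - y * (u s * x - u a) by ring.
  by apply: IB; apply: IM.
case: HI => _ /[apply] => -[Ia|]; last by right.
left; apply: Aprime_saturated Ss _.
by rewrite -(subrK (u a) (u s * x)); apply: ID.
Qed.

(** A maximal saturated ideal N containing I is prime, hence generated by
    elements u(a); as N contains no u(s) with s in the complement, all these
    generators are in I. *)
Lemma Aprime_extended_prime :
  (forall P, is_prime_ideal P -> extended_ideal u P) -> is_prime_ideal I.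
Proof.
move=> ext; pose T := image_mult u Aprime_compl.
have HT : saturated_submod idfun T I.
  split=> // t x [s Ss <-] /=; exact: Aprime_saturated.
have [N [[N0 ND NM NS] N1 IN maxN]] := maximal_saturated HT I1.
have Nprime : is_prime_ideal N.
  split=> // x y Nxy; have [Nx|/maxN[t [r [Tt /= Nt]]]] := pselect (N x).
    by left.
  right; apply: NS Tt _ => /=.
  have -> : t * y = y * (t - r * x) + r * (x * y) by ring.
  by apply: ND; apply: NM.
suff -> : I = N by [].
apply/seteqP; split=> // x Nx; have [J _ EN] := ext _ Nprime.
rewrite EN in Nx; apply: Nx; split; first by case: HI => -[].
move=> _ [a Ja <-]; apply: contrapT => Sa; apply: N1.
apply: (NS (u a)); first by exists a.
by rewrite /= mulr1 EN; apply: sub_gen_smallest; exists a.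
Qed.

(** * Relative primes of an epimorphism *)

Local Notation S := Aprime_compl.
Local Notation T := (image_mult u S).
Local Notation "x %:F" := (frac_map T x).

(** The extension of I to the ring of fractions, with quotient the
    localization of B/I. *)
Let IF : set (fraction_ring T) :=
  [set z | exists s i, [/\ mult_set S s, I i & (u s)%:F * z = i%:F]].

Let IF0 : IF 0.
Proof.
by exists 1, 0; split=> //; [exact: mult_set1|rewrite mulr0 rmorph0].
Qed.

Let IFB x y : IF x -> IF y -> IF (x - y).
Proof.
move=> [s [i [Ss Ii Ex]]] [t [j [St Ij Ey]]].
exists (s * t), (u t * i - u s * j); split.
- exact: mult_setM.
- by apply: IB; apply: IM.
- transitivity ((u t)%:F * ((u s)%:F * x) - (u s)%:F * ((u t)%:F * y)).
    by ring.
  by rewrite Ex Ey; ring.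
Qed.

Let IFMr x c : IF x -> IF (x * c%:F).
Proof.
move=> [s [i [Ss Ii Ex]]]; exists s, (c * i); split=> //; first exact: IM.
by rewrite mulrA Ex; ring.
Qed.

Let IF_frac x : IF x%:F -> I x.
Proof.
move=> [s [i [Ss Ii Ex]]].
have /frac_map_eq0[_ [t St <-]] : (u s * x - i)%:F = 0.
  by rewrite rmorphB rmorphM Ex subrr.
rewrite mulrBr => E; apply: (Aprime_saturated Ss).
apply: (Aprime_saturated St).
by rewrite -(subrK (u t * i) (_ * (_ * x))) E add0r; apply: IM.
Qed.

Let IF_saturated s z : mult_set S s -> IF ((u s)%:F * z) -> IF z.
Proof.
move=> Ss [t [i [St Ii Ez]]]; exists (t * s), i; split=> //.
  exact: mult_setM.
by rewrite !rmorphM -mulrA.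
Qed.

(** The k-linear form with kernel N and value 1 at 1, as a relation: x goes to
    the fraction a/s with s x = a modulo N. *)
Let form (N : set B) x z :=
  exists s a, [/\ mult_set S s, N (u s * x - u a) & (u s)%:F * z = (u a)%:F].

Section Form.
Context (N : set B).
Hypotheses (HN : saturated_submod u S N) (N1 : ~ N 1) (IN : I `<=` N).
Hypothesis maxN :
  forall x, ~ N x -> exists s a, mult_set S s /\ N (u s - u a * x).

Let N_base a : N (u a) -> I (u a).
Proof.
case: HN => _ _ _ NS Na; apply: contrapT => Sa; apply: N1.
by apply: (NS a) => //; rewrite mulr1.
Qed.

Lemma form_ex x : exists z, form N x z.
Proof.
suff [s [a [Ss Nx]]] : exists s a, mult_set S s /\ N (u s * x - u a).
  have /frac_map_inv[w Ew] : mult_set T (u s) by exists s.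
  by exists (w * (u a)%:F), s, a; split=> //; rewrite mulrCA mulrA Ew mul1r.
have [Nx|/maxN[s [a [Ss Ns]]]] := pselect (N x).
  exists 1, 0; split; first exact: mult_set1.
  by rewrite rmorph0 rmorph1 mul1r subr0.
exists a, s; split; last by rewrite -opprB; apply: saturatedN HN _.
(* Otherwise u(a)x and hence u(s) would be in N. *)
move=> Ia; apply: Ss; apply: N_base; rewrite -(subrK (u a * x) (u s)).
by case: HN => _ ND _ _; apply: ND => //; apply: IN; rewrite mulrC; apply: IM.
Qed.

Lemma form_uniq x z z' : form N x z -> form N x z' -> IF (z - z').
Proof.
move=> [s [a [Ss Ns Ez]]] [t [b [St Nt Ez']]].
apply: (IF_saturated (s := s * t)); first exact: mult_setM.
have -> : (u (s * t))%:F * (z - z') = (u (t * a - s * b))%:F.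
  transitivity ((u t)%:F * ((u s)%:F * z) - (u s)%:F * ((u t)%:F * z')).
    by ring.
  by rewrite Ez Ez'; ring.
exists 1, (u (t * a - s * b)); split; first exact: mult_set1.
  apply: N_base; case: HN => _ _ NZ _.
  have -> : u (t * a - s * b) =
    u s * (u t * x - u b) - u t * (u s * x - u a) by ring.
  by apply: saturatedB HN _ _; apply: NZ.
by rewrite rmorph1 rmorph1 mul1r.
Qed.

Lemma formD x y z z' : form N x z -> form N y z' -> form N (x + y) (z + z').
Proof.
move=> [s [a [Ss Ns Ez]]] [t [b [St Nt Ez']]].
exists (s * t), (t * a + s * b); split; first exact: mult_setM.
- case: HN => _ ND NZ _.
  have -> : u (s * t) * (x + y) - u (t * a + s * b) =
    u t * (u s * x - u a) + u s * (u t * y - u b) by ring.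
  by apply: ND; apply: NZ.
- transitivity ((u t)%:F * ((u s)%:F * z) + (u s)%:F * ((u t)%:F * z')).
    by ring.
  by rewrite Ez Ez'; ring.
Qed.

Lemma formZ c x z : form N x z -> form N (u c * x) ((u c)%:F * z).
Proof.
move=> [s [a [Ss Ns Ez]]]; exists s, (c * a); split=> //.
  case: HN => _ _ NZ _.
  have -> : u s * (u c * x) - u (c * a) = u c * (u s * x - u a) by ring.
  exact: NZ.
by rewrite mulrCA Ez !rmorphM.
Qed.

Lemma form1 : form N 1 1.
Proof.
case: HN => N0 _ _ _; exists 1, 1; split; first exact: mult_set1.
  by rewrite mulr1 subrr.
by rewrite mulr1.
Qed.

Lemma form_ker x : N x -> form N x 0.
Proof.
move=> Nx; exists 1, 0; split; first exact: mult_set1.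
  by rewrite rmorph0 rmorph1 mul1r subr0.
by rewrite mulr0 !rmorph0.
Qed.

(** Apply L (x) id to b (x) 1 = 1 (x) b, where L is the linear form. *)
Lemma epimorphism_hyperplane b : ring_epimorphism u -> N b -> I b.
Proof.
move=> epi Nb; have [L HL] := choice form_ex.
have : IF (L b * 1%:F - L 1 * b%:F).
  apply: (@epimorphism_balanced _ _ _ _ IF (fun x y => L x * y%:F) b epi) => //.
  - move=> x x' y; rewrite -mulrDl -mulrBl; apply: IFMr.
    by apply: form_uniq (HL _) _; apply: formD.
  - by move=> x y y'; rewrite rmorphD mulrDr subrr.
  - move=> a x y.
    have -> : L (u a * x) * y%:F - L x * (u a * y)%:F =
      (L (u a * x) - (u a)%:F * L x) * y%:F by ring.
    by apply/IFMr/(form_uniq (HL _))/formZ.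
have Lb : IF (0 - L b) := form_uniq (form_ker Nb) (HL b).
have L1 : IF (1 - L 1) := form_uniq form1 (HL 1).
move=> Lb1; apply: IF_frac.
have -> : b%:F = (1 - L 1) * b%:F - (0 - L b) * 1%:F
                 - (L b * 1%:F - L 1 * b%:F) by ring.
by apply: IFB => //; apply: IFB; apply: IFMr.
Qed.

End Form.

Lemma Aprime_epimorphism_prime : ring_epimorphism u -> is_prime_ideal I.
Proof.
move=> epi; apply: Aprime_fraction_prime => b; apply: contrapT => nfrac.
have HS : saturated_submod u S I.
  by split=> // [a x|s x Ss]; [exact: IM|exact: Aprime_saturated].
have [|N [HN N1 IN maxN]] :=
  maximal_saturated (adjoin_saturated b HS).
  (* A relation u(s) = u(a)b modulo I with s in S forces a to be in S. *)
  move=> [s [a [Ss]]]; rewrite mulr1 => Is.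
  apply: nfrac; exists a, s; split; last first.
    by rewrite -opprB -sub0r; apply: IB.
  move=> Ia; apply: Ss; rewrite -(subrK (u a * b) (u s)).
  by apply: ID => //; rewrite mulrC; apply: IM.
apply: nfrac; exists 1, 0; split; first by rewrite rmorph1.
rewrite rmorph0 rmorph1 mul1r subr0.
apply: epimorphism_hyperplane HN N1 _ maxN _ epi _.
- by move=> x /(@adjoin_sub _ _ u S I b)/IN.
- exact/IN/adjoin_mem.
Qed.

End Aprime.

(** * Morphisms all of whose relative primes are prime *)

Theorem proposition2p8 (A B : comPzRingType) (u : {rmorphism A -> B}) :
  [/\ (forall P : set B, is_prime_ideal P -> extended_ideal u P) ->
        PSI_morphism u,
      ring_epimorphism u -> PSI_morphism u,
      (forall b : B, exists a : A, u a = b) -> PSI_morphism u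
    & forall S : multSubset A, is_fraction_map u S -> PSI_morphism u].
Proof.
split=> [ext|epi|surj|S [phi [psi _ phiK] Eu]] I HI.
- exact: Aprime_extended_prime HI ext.
- exact: Aprime_epimorphism_prime HI epi.
- have [[[I0 _ _] I1] _] := HI.
  apply: (Aprime_fraction_prime HI) => b; have [a <-] := surj b.
  by exists 1, a; rewrite rmorph1 mul1r subrr.
- have [[[I0 _ IM] I1] _] := HI.
  apply: (Aprime_fraction_prime HI) => b.
  have [s [a [Ss Es]]] := frac_map_num (psi b).
  exists s, a; split; last first.
    by rewrite !Eu -Es rmorphM phiK subrr.
  (* u(s) is a unit of B, so it is not in the proper ideal I. *)
  have [w Ew] := frac_map_inv Ss; move=> /(IM (phi w)).
  by rewrite Eu -rmorphM Ew rmorph1.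
Qed.
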